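(* Let $G_1=(V_1,E_1)$ and $G_2=(V_2,E_2)$ be finite graphs, and let $x_1,\ldots,x_k\in V_1$ and $y_1,\ldots,y_k\in V_2$ be distinct distinguished vertices. Let $G_1\# G_2$ be their connected sum along these vertices. Then \[ M(G_1\# G_2)=\sum_{(\epsilon_1,\ldots,\epsilon_k)\in\{y,n\}^k} G_1(\epsilon_1,\ldots,\epsilon_k)\, G_2(\bar\epsilon_1,\ldots,\bar\epsilon_k). \]
   Context: Graphs are finite and may have multiple edges. A perfect matching of a graph is a set of edges such that every vertex is incident to exactly one edge of the set; $M(G)$ denotes the number of perfect matchings of $G$ (the graph with no vertices has exactly one perfect matching, the empty one). For a graph $G$ with distinguished vertices $v_1,\ldots,v_k$ and $(\epsilon_1,\ldots,\epsilon_k)\in\{y,n\}^k$ (here $y,n$ are two formal symbols), $G(\epsilon_1,\ldots,\epsilon_k)$ is the number of perfect matchings of the graph obtained from $G$ by deleting each vertex $v_i$ with $\epsilon_i=y$ (together with its incident edges) and keeping each $v_i$ with $\epsilon_i=n$. The involution $\epsilon\mapsto\bar\epsilon$ exchanges $y$ and $n$. The connected sum $G_1\# G_2$ is the graph with vertex set $(V_1\sqcup V_2)/(x_i\sim y_i \text{ for all } 1\le i\le k)$ and edge set $E_1\sqcup E_2$ (each edge keeping its endpoints, read in the quotient). *)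

(* Defs.v *)
From mathcomp Require Import all_boot.

Set Implicit Arguments.
Unset Strict Implicit.
Unset Printing Implicit Defensive.

Local Open Scope quotient_scope.

(* Multigraphs: edges form a type of their own, so parallel edges are distinct
   edges with the same set of ends.  A loop is an edge with a single end; it is
   incident to that end, like any other edge. *)
Record graph := Graph {
  vertex : finType;
  edge : finType;
  ends : edge -> {set vertex};
  ends_card : forall e : edge, 0 < #|ends e| <= 2
}.

Definition perfect_matching (G : graph) (S : {set edge G}) : bool :=
  [forall v : vertex G, #|[set e in S | v \in ends e]| == 1].

Definition M (G : graph) : nat :=
  #|[set S : {set edge G} | perfect_matching S]|.

Section Delete.
Variables (G : graph) (D : {set vertex G}).

Definition del_vertex : finType := {v : vertex G | v \notin D}.

Definition del_edge : finType := {e : edge G | [disjoint ends e & D]}.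

Definition del_ends (e : del_edge) : {set del_vertex} :=
  [set v : del_vertex | val v \in ends (val e)].

Lemma del_ends_card (e : del_edge) : 0 < #|del_ends e| <= 2.
Proof.
suff -> : #|del_ends e| = #|ends (val e)| by exact: ends_card.
rewrite -(card_imset (mem (del_ends e)) val_inj).
apply: eq_card => v; apply/imsetP/idP => [[w + ->]|ve]; first by rewrite inE.
have vD : v \notin D by rewrite (disjointFr (valP e) ve).
by exists (exist (fun v => v \notin D) v vD); rewrite ?inE.
Qed.

Definition delete : graph := Graph del_ends_card.

End Delete.

(* The symbols y and n are encoded as true and false: vertex x i is deleted
   when eps i = true and kept when eps i = false. *)
Definition M_at (G : graph) (k : nat) (x : 'I_k -> vertex G)
    (eps : {ffun 'I_k -> bool}) : nat :=
  M (delete [set x i | i : 'I_k & eps i]).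

Definition bar (k : nat) (eps : {ffun 'I_k -> bool}) : {ffun 'I_k -> bool} :=
  [ffun i => ~~ eps i].

Section ConnectedSum.
Variables (G1 G2 : graph) (k : nat).
Variables (x : 'I_k -> vertex G1) (y : 'I_k -> vertex G2).

Definition glue_step : rel (vertex G1 + vertex G2) := fun u v =>
  [exists i, (u == inl (x i)) && (v == inr (y i))
          || (u == inr (y i)) && (v == inl (x i))].

(* The equivalence relation generated by x i ~ y i: [connect] is the reflexive
   transitive closure, and [glue_step] is symmetric. *)
Definition glue : rel (vertex G1 + vertex G2) := connect glue_step.

Lemma glue_sym : symmetric glue.
Proof.
apply: sym_connect_sym => u v; apply: eq_existsb => i.
by rewrite orbC ![(v == _) && _]andbC.
Qed.

Canonical glue_equiv :=
  EquivRel glue (connect0 glue_step) glue_sym (@connect_trans _ glue_step).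

(* [quot_type Q] is the library's alias of Q carrying the finType structure. *)
Definition csum_vertex : finType := quot_type {eq_quot glue_equiv}.

Definition csum_class (u : vertex G1 + vertex G2) : csum_vertex :=
  \pi_({eq_quot glue_equiv}) u.

Definition csum_ends (e : edge G1 + edge G2) : {set csum_vertex} :=
  match e with
  | inl e1 => [set csum_class (inl v) | v in ends e1]
  | inr e2 => [set csum_class (inr v) | v in ends e2]
  end.

Lemma csum_ends_card (e : edge G1 + edge G2) : 0 < #|csum_ends e| <= 2.
Proof.
case: e => e /=; have /andP[/card_gt0P[v ve] le2] := ends_card e;
  rewrite (leq_trans (leq_imset_card _ _) le2) andbT;
  by apply/card_gt0P; eexists; apply: imset_f ve.
Qed.

Definition connected_sum : graph := Graph csum_ends_card.

End ConnectedSum.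

(* Main.v *)
(* A vertex of the connected sum that is not glued is covered by S exactly as
   often as in its own graph, while the glued vertex x_i ~ y_i is covered
   deg(x_i) + deg(y_i) times.  Hence S is perfect iff each unglued vertex is
   covered once and, for each i, exactly one of x_i, y_i is covered, once; the
   side on which x_i is left uncovered determines eps. *)
Require Import Defs.
From mathcomp Require Import all_boot.

Set Implicit Arguments.
Unset Strict Implicit.
Unset Printing Implicit Defensive.

Definition deg (G : graph) (S : {set edge G}) (v : vertex G) : nat :=
  #|[set e in S | v \in ends e]|.

Lemma perfect_matchingP (G : graph) (S : {set edge G}) :
  reflect (forall v, deg S v = 1) (perfect_matching S).
Proof. by apply: (iffP forallP) => pS v; apply/eqP/pS. Qed.

(** This describes the perfect matchings of [delete D] as edge sets of [G] itself, avoiding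
    subtypes: degree 0 on [D] already forces every edge of [S] to miss [D]. *)
Definition perfect_off (G : graph) (D : {set vertex G}) (S : {set edge G}) :=
  [forall v : vertex G, deg S v == (v \notin D)].

Lemma deg_delete (G : graph) (D : {set vertex G})
    (S : {set edge (delete D)}) (v : vertex (delete D)) :
  deg S v = deg (val @: S) (val v).
Proof.
rewrite /deg -(card_imset _ val_inj); apply: eq_card => e.
apply/imsetP/setIdP => [[f /setIdP[fS vf] ->]|[/imsetP[f fS ->] vf]].
  by split; [apply: imset_f | move: vf; rewrite inE].
by exists f => //; rewrite inE fS inE.
Qed.

(** Taking images under [val] is injective on edge sets and preserves degrees outside [D]; a set
    with degree 0 on [D] contains only edges that survive the deletion, so it is such an image. *)
Lemma M_delete (G : graph) (D : {set vertex G}) :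
  M (delete D) = #|[set S | perfect_off D S]|.
Proof.
rewrite /M -(card_imset _ (imset_inj val_inj)); apply: eq_card => S.
rewrite inE; apply/imsetP/forallP => [[S' + ->] v|offS].
  rewrite inE => /perfect_matchingP pS; case: (boolP (v \in D)) => vD /=.
    rewrite cards_eq0; apply/eqP/setP => e; rewrite !inE; apply/negP.
    by case/andP=> /imsetP[f _ ->]; rewrite (disjointFl (valP f) vD).
  by have := pS (Sub v vD); rewrite deg_delete => ->.
have SD e : e \in S -> [disjoint ends e & D].
  move=> eS; apply/pred0P => v /=; apply/negP => /andP[ve vD].
  have := offS v; rewrite vD cards_eq0 => /eqP/setP/(_ e).
  by rewrite !inE eS ve.
have defS : S = val @: [set e : edge (delete D) | val e \in S].
  apply/setP => e; apply/idP/imsetP => [eS|[f + ->]]; last by rewrite inE.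
  by exists (Sub e (SD e eS)); rewrite ?inE.
exists [set e | val e \in S] => //.
rewrite inE; apply/perfect_matchingP => v.
by rewrite deg_delete -defS (eqP (offS _)) (valP v).
Qed.

Section ConnectedSum.
Variables (G1 G2 : graph) (k : nat).
Variables (x : 'I_k -> vertex G1) (y : 'I_k -> vertex G2).
Hypotheses (x_inj : injective x) (y_inj : injective y).

Local Notation G := (connected_sum x y).
Local Notation class := (csum_class x y).

(** Since [x] and [y] are injective, a second gluing step can only undo the first, so the transitive
    closure adds nothing: each class has at most two elements. *)
Lemma glueE u v : glue x y u v = (u == v) || glue_step x y u v.
Proof.
apply/idP/orP => [|[/eqP->|]]; [|exact: connect0|exact: connect1].
case/connectP => p + ->; elim: p u => [|w p IHp] u /=; first by left.
case/andP => uw /IHp[/eqP <-|wv]; first by right.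
left; case/existsP: uw => i; case/existsP: wv => j.
case/orP=> /andP[/eqP -> /eqP ->]; case/orP=> /andP[/eqP -> /eqP] //.
  by case=> /x_inj ->.
by case=> /y_inj ->.
Qed.

Lemma csum_class_eq u v : (class u == class v) = glue x y u v.
Proof. by apply/eqP/idP => /eqmodP. Qed.

(** A gluing step always changes sides, so two distinct vertices of the same graph are never
    identified. *)
Lemma class_inl_eq v w : (class (inl v) == class (inl w)) = (v == w).
Proof.
rewrite csum_class_eq glueE [glue_step _ _ _ _](_ : _ = false) ?orbF //.
by apply/existsP => -[i]; rewrite /= andbF.
Qed.

Lemma class_inr_eq v w : (class (inr v) == class (inr w)) = (v == w).
Proof.
rewrite csum_class_eq glueE [glue_step _ _ _ _](_ : _ = false) ?orbF //.
by apply/existsP => -[i]; rewrite /= andbF.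
Qed.

Lemma class_inl_inr_eq v w :
  (class (inl v) == class (inr w)) = [exists i, (v == x i) && (w == y i)].
Proof.
by rewrite csum_class_eq glueE /=; apply: eq_existsb => i; rewrite orbF.
Qed.

Definition left_edges (S : {set edge G}) : {set edge G1} := inl @^-1: S.
Definition right_edges (S : {set edge G}) : {set edge G2} := inr @^-1: S.

Lemma deg_connected_sum (S : {set edge G}) c :
  deg S c =
  #|[set e in left_edges S | c \in csum_ends x y (inl e)]| +
  #|[set e in right_edges S | c \in csum_ends x y (inr e)]|.
Proof.
rewrite /deg -!sum1_card big_sumType /=.
by congr addn; apply: eq_bigl => e; rewrite !inE.
Qed.

Lemma class_inl_ends v e :
  (class (inl v) \in csum_ends x y (inl e)) = (v \in ends e).
Proof.
apply/imsetP/idP => [[w we /eqP]|ve]; last by exists v.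
by rewrite class_inl_eq => /eqP->.
Qed.

Lemma class_inr_ends v e :
  (class (inr v) \in csum_ends x y (inr e)) = (v \in ends e).
Proof.
apply/imsetP/idP => [[w we /eqP]|ve]; last by exists v.
by rewrite class_inr_eq => /eqP->.
Qed.

Lemma class_glued i : class (inl (x i)) = class (inr (y i)).
Proof.
by apply/eqP; rewrite class_inl_inr_eq; apply/existsP; exists i; rewrite !eqxx.
Qed.

Lemma deg_glued (S : {set edge G}) i :
  deg S (class (inl (x i))) =
  deg (left_edges S) (x i) + deg (right_edges S) (y i).
Proof.
rewrite deg_connected_sum; congr addn; apply: eq_card => e; rewrite !inE.
  by rewrite class_inl_ends.
by rewrite class_glued class_inr_ends.
Qed.

Lemma deg_inl (S : {set edge G}) v : v \notin codom x ->
  deg S (class (inl v)) = deg (left_edges S) v.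
Proof.
move=> vx; rewrite deg_connected_sum [X in _ + X]eq_card0 ?addn0 => [|e].
  by apply: eq_card => e; rewrite !inE class_inl_ends.
(* An edge of [G2] meeting this class would have an end glued to [v], putting [v] in the range of
   [x]. *)
rewrite !inE; apply/andP => -[_ /imsetP[w _ /eqP]].
rewrite class_inl_inr_eq => /existsP[i /andP[/eqP vi _]].
by rewrite vi codom_f in vx.
Qed.

Lemma deg_inr (S : {set edge G}) v : v \notin codom y ->
  deg S (class (inr v)) = deg (right_edges S) v.
Proof.
move=> vy; rewrite deg_connected_sum [X in X + _]eq_card0 ?add0n => [|e].
  by apply: eq_card => e; rewrite !inE class_inr_ends.
rewrite !inE; apply/andP => -[_ /imsetP[w _ /esym/eqP]].
rewrite class_inl_inr_eq => /existsP[i /andP[_ /eqP vi]].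
by rewrite vi codom_f in vy.
Qed.

Lemma perfect_matching_sumP (S : {set edge G}) :
  reflect [/\ forall i, deg (left_edges S) (x i)
                        + deg (right_edges S) (y i) = 1,
              forall v, v \notin codom x -> deg (left_edges S) v = 1
            & forall v, v \notin codom y -> deg (right_edges S) v = 1]
          (perfect_matching S).
Proof.
apply: (iffP (perfect_matchingP S)) => [pS|[gS lS rS] c].
  split=> [i|v vx|v vy]; first by rewrite -deg_glued.
    by rewrite -deg_inl.
  by rewrite -deg_inr.
have [u ->] : exists u, c = class u by exists (repr c); rewrite /csum_class reprK.
case: u => v.
  have [/codomP[i ->]|vx] := boolP (v \in codom x).
    by rewrite deg_glued gS.
  by rewrite deg_inl // lS.
have [/codomP[i ->]|vy] := boolP (v \in codom y).
  by rewrite -class_glued deg_glued gS.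
by rewrite deg_inr // rS.
Qed.

(** For a perfect matching [S], this is the one [eps] whose term counts [S]: true stands for a
    deleted [x i], which is then matched through [y i]. *)
Definition uncovered (S : {set edge G}) : {ffun 'I_k -> bool} :=
  [ffun i => deg (left_edges S) (x i) == 0].

End ConnectedSum.

Lemma perfect_offP (G : graph) (k : nat) (x : 'I_k -> vertex G)
    (eps : {ffun 'I_k -> bool}) (S : {set edge G}) : injective x ->
  reflect ((forall i, deg S (x i) = ~~ eps i) /\
           (forall v, v \notin codom x -> deg S v = 1))
          (perfect_off [set x i | i : 'I_k & eps i] S).
Proof.
move=> x_inj.
(* By injectivity, [x i] cannot be deleted on account of another index. *)
have xD i : (x i \in [set x i | i : 'I_k & eps i]) = eps i.
  by rewrite mem_imset // inE.
apply: (iffP forallP) => [offS|[gS lS] v].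
  split=> [i|v vx]; first by rewrite (eqP (offS _)) xD.
  rewrite (eqP (offS _)); case: imsetP => // -[i _ vi].
  by rewrite vi codom_f in vx.
have [/codomP[i ->]|vx] := boolP (v \in codom x); first by rewrite gS xD.
rewrite lS //; case: imsetP => // -[i _ vi].
by rewrite vi codom_f in vx.
Qed.

(** Two degrees summing to 1 are 0 and 1 in some order; fixing [eps] fixes the order at every glued
    vertex, and the conditions on the two sides become independent. *)
Lemma perfect_matching_split (G1 G2 : graph) (k : nat)
    (x : 'I_k -> vertex G1) (y : 'I_k -> vertex G2)
    (x_inj : injective x) (y_inj : injective y)
    (eps : {ffun 'I_k -> bool}) (S : {set edge (connected_sum x y)}) :
  perfect_matching S && (uncovered S == eps) =
  perfect_off [set x i | i : 'I_k & eps i] (left_edges S) &&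
  perfect_off [set y i | i : 'I_k & bar eps i] (right_edges S).
Proof.
apply/andP/andP => [[/perfect_matching_sumP[]// gS lS rS /eqP <-]|].
  split; apply/perfect_offP => //; split=> // i; move: (gS i); rewrite !ffunE.
    by case: deg => [|[|n]].
  by rewrite negbK; case: deg => [|[|n]] //= [].
case=> /perfect_offP[]// gS1 lS /perfect_offP[]// gS2 rS; split.
  apply/perfect_matching_sumP => //; split=> // i.
  by rewrite gS1 gS2 !ffunE; case: (eps i).
by apply/eqP/ffunP => i; rewrite !ffunE gS1; case: (eps i).
Qed.

Theorem theorem1p1 (G1 G2 : graph) (k : nat)
    (x : 'I_k -> vertex G1) (y : 'I_k -> vertex G2)
    (x_inj : injective x) (y_inj : injective y) :
  M (connected_sum x y) =
  \sum_(eps : {ffun 'I_k -> bool}) M_at x eps * M_at y (bar eps).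
Proof.
(* Sort the perfect matchings by their pattern [uncovered]; each fibre is then compared with one
   term of the sum. *)
rewrite {1}/M -sum1_card (partition_big (@uncovered _ _ _ x y) xpredT) //=.
apply: eq_bigr => eps _; rewrite /M_at !M_delete -cardsX sum1_card.
(* The term is now the size of a product of two sets; [split] maps the fibre over [eps] bijectively
   onto it. *)
pose split (S : {set edge (connected_sum x y)}) := (left_edges S, right_edges S).
have split_inj : injective split.
  move=> S T [/setP eql /setP eqr]; apply/setP => -[e|e].
    by have := eql e; rewrite !inE.
  by have := eqr e; rewrite !inE.
rewrite -(card_imset _ split_inj); apply: eq_card => -[S1 S2].
rewrite !inE /=; apply/imsetP/idP => [[S + [-> ->]]|offS].
  by rewrite unfold_in inE perfect_matching_split.
(* The preimage of a pair is the disjoint union of its two edge sets. *)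
pose S : {set edge (connected_sum x y)} :=
  [set e : edge G1 + edge G2 | match e with inl e => e \in S1 | inr e => e \in S2 end].
have [lS rS] : left_edges S = S1 /\ right_edges S = S2.
  by split; apply/setP => e; rewrite !inE.
by exists S; rewrite /split ?lS ?rS // unfold_in inE perfect_matching_split ?lS ?rS.
Qed.
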